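(* Let $p=3$, let $n_1,n_2\ge1$, $s\ge0$ and $n=n_1+2n_2+s$, and let $f:\mathbb{F}_3^{n}=\mathbb{F}_3^{n_1}\times\mathbb{F}_3^{n_2}\times\mathbb{F}_3^{n_2}\times\mathbb{F}_3^{s}\to\mathbb{F}_3$ be the function $f(x,y,z,r)=f^{(z)}(x)+\sum_{i=1}^{n_2}y_iz_i$, where $f^{(0)}(x)=\sum_{i=1}^{n_1}u_ix_i^2$ and $f^{(z)}(x)=\sum_{i=1}^{n_1}v_ix_i^2$ for $z\ne0$, with $u_i,v_i\in\mathbb{F}_3^*$; let $\epsilon_0$ be the type of $f$. Let $\alpha_i=e_i$ for $1\le i\le n_1$ and $\alpha_i=e_1+e_i$ for $n_1<i\le n$, let $H^{(1)}=(\alpha_i\cdot\alpha_j)_{1\le i,j\le n}$, let $T$ be a subset of $D_{f,0}\setminus\{0\}$ such that every element of $D_{f,0}\setminus\{0\}$ is uniquely $ax$ with $a\in\mathbb{F}_3^*$, $x\in T$, and let $G$ be the $n\times\#T$ matrix whose $i$-th row is $(\alpha_i\cdot x)_{x\in T}$, and $G'=[H^{(1)},G]$. If $n+s$ is even with $0\le s\le n-4$ and $n+s\ge6$, then $G'$ generates a ternary $[\frac{3^{n-1}+2\epsilon_0\cdot3^{\frac{n+s}{2}-1}-1}{2}+n,\,n]$ LCD code $\mathcal{C}$, and $\mathcal{C}^\perp$ is a ternary $[\frac{3^{n-1}+2\epsilon_0\cdot3^{\frac{n+s}{2}-1}-1}{2}+n,\,\frac{3^{n-1}+2\epsilon_0\cdot3^{\frac{n+s}{2}-1}-1}{2},\,3]$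 LCD code. If $n+s$ is odd with $0\le s\le n-3$ and $n+s\ge5$, then $G'$ generates a ternary $[\frac{3^{n-1}-1}{2}+n,\,n]$ LCD code $\mathcal{C}$, and $\mathcal{C}^\perp$ is a ternary $[\frac{3^{n-1}-1}{2}+n,\,\frac{3^{n-1}-1}{2},\,3]$ LCD code.
   Context: $\mathbb{F}_3^n$ carries the dot product $a\cdot b=\sum a_ib_i$, and $e_i$ is the $i$-th standard basis vector (coordinates ordered as $x,y,z,r$). $D_{f,0}=\{w:f(w)=0\}$. Walsh transform: $\widehat{\chi_f}(\alpha)=\sum_{w}\xi_3^{f(w)-\alpha\cdot w}$ with $\xi_3=e^{2\pi\sqrt{-1}/3}$; the function $f$ above is $s$-plateaued, i.e. $|\widehat{\chi_f}(\alpha)|\in\{0,3^{(n+s)/2}\}$, and $\widehat{\chi_f}(0)=\epsilon_0\mu 3^{(n+s)/2}\xi_3^{c}$ for some $c\in\mathbb{F}_3$, with $\epsilon_0\in\{\pm1\}$ (the type of $f$), where $\mu=1$ if $3^{n+s}\equiv1\pmod4$ and $\mu=\sqrt{-1}$ otherwise. A linear code is LCD if $\mathcal{C}\cap\mathcal{C}^\perp=\{0\}$ (dual w.r.t. the dot product); $[N,K,d]$ = length, dimension, minimum distance. *)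

(* Defs.v *)
From HB Require Import structures.
From mathcomp Require Import all_boot all_order all_algebra all_field.
Set Implicit Arguments. Unset Strict Implicit. Unset Printing Implicit Defensive.
Import Order.TTheory GRing.Theory Num.Theory.
Local Open Scope ring_scope.

Notation F3 := 'F_3.

Definition dot (N : nat) (a b : 'rV[F3]_N) : F3 := \sum_(i < N) a 0 i * b 0 i.

Definition coord_at (N : nat) (w : 'rV[F3]_N) (k : nat) : F3 :=
  if insub k is Some i then w 0 i else 0.

(* f(x,y,z,r) = f^(z)(x) + sum_i y_i z_i, with coordinates ordered x (n1),
   y (n2), z (n2), r (s); f^(0)(x) = sum u_i x_i^2, f^(z)(x) = sum v_i x_i^2 (z<>0). *)
Definition fquad (n1 n2 N : nat) (u v : 'I_n1 -> F3) (w : 'rV[F3]_N) : F3 :=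
  (if [forall j : 'I_n2, coord_at w (n1 + n2 + j) == 0]
   then \sum_(i < n1) u i * coord_at w i ^+ 2
   else \sum_(i < n1) v i * coord_at w i ^+ 2)
  + \sum_(j < n2) coord_at w (n1 + j) * coord_at w (n1 + n2 + j).

(* xi_3 = e^{2 pi sqrt(-1)/3} = (-1 + sqrt(-3))/2 in algC. *)
Definition xi3 : algC := (-1 + 'i * sqrtC 3) / 2.

Definition walsh (N : nat) (f : 'rV[F3]_N -> F3) (alpha : 'rV[F3]_N) : algC :=
  \sum_(w : 'rV[F3]_N) xi3 ^+ (val (f w - dot alpha w)).

Definition mu (m : nat) : algC := if (3 ^ m %% 4 == 1)%N then 1 else 'i.

Definition is_type (N s : nat) (f : 'rV[F3]_N -> F3) (eps : int) : Prop :=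
  (eps = 1 \/ eps = -1) /\
  exists c : F3, walsh f 0 = eps%:~R * mu (N + s) * sqrtC 3 ^+ (N + s) * xi3 ^+ (val c).

Definition alpha (n1 N : nat) (i : 'I_N) : 'rV[F3]_N :=
  \row_(j < N) (if (i < n1)%N then (j == i)%:R
                else ((val j == 0)%N)%:R + (j == i)%:R).

Definition H1 (n1 N : nat) : 'M[F3]_N := \matrix_(i, j) dot (alpha n1 i) (alpha n1 j).

Definition Gmat (n1 N : nat) (T : {set 'rV[F3]_N}) : 'M[F3]_(N, #|T|) :=
  \matrix_(i < N, j < #|T|) dot (alpha n1 i) (enum_val j).

Definition Gprime (n1 N : nat) (T : {set 'rV[F3]_N}) : 'M[F3]_(N, N + #|T|) :=
  row_mx (H1 n1 N) (Gmat n1 T).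

(* Linear codes are row spaces of generator matrices. *)
Definition dual_code (k L : nat) (M : 'M[F3]_(k, L)) : 'M[F3]_L := kermx M^T.

Definition is_LCD (k L : nat) (M : 'M[F3]_(k, L)) : bool :=
  ((M :&: dual_code M)%MS == 0 :> 'M[F3]_L).

Definition wt (L : nat) (v : 'rV[F3]_L) : nat := #|[set i : 'I_L | v 0 i != 0]|.

Definition min_dist_is (k L : nat) (M : 'M[F3]_(k, L)) (d : nat) : Prop :=
  (exists v : 'rV[F3]_L, [/\ (v <= M)%MS, v != 0 & wt v = d]) /\
  (forall v : 'rV[F3]_L, (v <= M)%MS -> v != 0 -> (d <= wt v)%N).

(* Main.v *)
(* Write chi for the character t |-> xi_3 ^ t of F_3.  Then
   3 #D_{f,0} = 3^n + sum_w chi(f w) + sum_w chi(- f w).  The terms with z != 0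
   cancel along the coordinates y, and changing the sign of one coefficient u_i
   changes the sign of the Gauss sum in x_i, so the last sum is (-1)^{n_1} times
   the Walsh value at 0.  For n_1 odd the two sums cancel; for n_1 even the Walsh
   value is real, which forces c = 0.

   Let A be the unitriangular matrix with rows alpha_i and X the matrix with
   columns x in T, so G' = A [A^T, X].  The entries of X X^T are, up to sign, the
   sums over D_{f,0} of w_i w_j; expanding the indicator of f = 0 as 1 - f^2, these
   vanish because a polynomial of degree < 2n on F_3^n sums to 0.  Hence
   G' G'^T = (A A^T)^2 is invertible, and both codes are LCD.  The columns of G'
   correspond under A to the alpha_i and to T; these are pairwise non-proportional
   since f(alpha_i) != 0, while e_{n_1+1} = alpha_{n_1+1} - alpha_1 lies in
   D_{f,0}: the dual distance is 3. *)
Require Import Defs.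
From HB Require Import structures.
From mathcomp Require Import all_boot all_order all_algebra all_field.
From mathcomp Require Import ring lra zify.
Set Implicit Arguments. Unset Strict Implicit. Unset Printing Implicit Defensive.
Import Order.TTheory GRing.Theory Num.Theory.
Local Open Scope ring_scope.

(** * Arithmetic in the field with three elements *)

Lemma F3_cases (x : 'F_3) : [\/ x = 0, x = 1 | x = -1].
Proof.
by case: x => [[|[|[|//]]] lt_x3]; [apply: Or31 | apply: Or32 | apply: Or33];
  apply: val_inj.
Qed.

Lemma F3_sqr (x : 'F_3) : x != 0 -> x ^+ 2 = 1.
Proof. by case: (F3_cases x) => -> //; rewrite ?eqxx // ?sqrrN expr1n. Qed.

Lemma sum_F3 (V : nmodType) (g : 'F_3 -> V) : \sum_t g t = g 0 + g 1 + g (-1).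
Proof.
rewrite !big_ord_recl big_ord0 addr0 addrA.
by congr (g _ + g _ + g _); apply: val_inj.
Qed.

(** * Sums of polynomial functions over F_3^N *)

Section LineSums.
Variables (N : nat) (k : 'I_N).

(** Each vector is uniquely a point of the hyperplane w_k = 0 plus a multiple of e_k. The
    cancellations below take place along such lines. *)
Lemma sum_over_lines (V : nmodType) (g : 'rV['F_3]_N -> V) :
  \sum_w g w = \sum_(w : 'rV['F_3]_N | w 0 k == 0) \sum_t g (w + t *: delta_mx 0 k).
Proof.
rewrite pair_big_dep /=.
rewrite (reindex (fun w : 'rV['F_3]_N => (w - w 0 k *: delta_mx 0 k, w 0 k))) /=.
  apply: eq_big => [w|w _]; last by rewrite subrK.
  by rewrite !mxE !eqxx mulr1 subrr eqxx.
exists (fun p => p.1 + p.2 *: delta_mx 0 k) => [w _|[w t]] /=; first by rewrite subrK.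
rewrite inE /= andbT => /eqP wk0.
by rewrite !mxE !eqxx wk0 mulr1 add0r addrK.
Qed.

(** On a line in direction e_k only a factor t^0 or t^1 varies, and both 1 + 1 + 1 and 0 + 1 - 1
    vanish in F_3; t^2 would sum to 2. *)
Lemma sum_monomial_low_degree (l : seq 'I_N) :
  (count_mem k l < 2)%N -> \sum_(w : 'rV_N) \prod_(i <- l) w 0 i = 0 :> 'F_3.
Proof.
move=> le_k1; rewrite sum_over_lines big1 // => w /eqP wk0.
under eq_bigr do rewrite (bigID (pred1 k)) /=.
rewrite (eq_bigr (fun t => t ^+ count_mem k l * \prod_(i <- l | i != k) w 0 i)) => [|t _].
  rewrite -mulr_suml sum_F3.
  case: (count_mem k l) le_k1 => [|[|//]] _; last by rewrite !expr1 add0r subrr mul0r.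
  by rewrite !expr0 (_ : 1 + 1 + 1 = 0) ?mul0r //; apply: val_inj.
congr (_ * _).
  rewrite (eq_bigr (fun=> t)) => [|i /eqP->]; last by rewrite !mxE !eqxx wk0 mulr1 add0r.
  by rewrite big_const_seq iter_mulr_1.
by apply: eq_bigr => i neq_ik; rewrite !mxE (negPf neq_ik) andbF mulr0 addr0.
Qed.
End LineSums.

Section PolynomialDegree.
Variable N : nat.
Implicit Types g h : 'rV['F_3]_N -> 'F_3.

(** A monomial is a coefficient with a list of coordinates, repetitions giving exponents. The bound
    concerns some polynomial representing the function, so no normal form is required. *)
Definition deg_le d g := exists2 L : seq ('F_3 * seq 'I_N),
  all (fun m => (size m.2 <= d)%N) L &
  forall w, g w = \sum_(m <- L) m.1 * \prod_(i <- m.2) w 0 i.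

Lemma eq_deg_le d g h : g =1 h -> deg_le d g -> deg_le d h.
Proof. by move=> gh [L Ld gE]; exists L => // w; rewrite -gh. Qed.

Lemma deg_le_const d c : deg_le d (fun=> c).
Proof. by exists [:: (c, [::])] => // w; rewrite big_seq1 big_nil mulr1. Qed.

Lemma deg_le_coord i : deg_le 1 (fun w => w 0 i).
Proof. by exists [:: (1, [:: i])] => // w; rewrite !big_seq1 mul1r. Qed.

Lemma deg_leD d g h : deg_le d g -> deg_le d h -> deg_le d (fun w => g w + h w).
Proof.
move=> [L Ld gE] [M Md hE]; exists (L ++ M); first by rewrite all_cat Ld.
by move=> w; rewrite gE hE big_cat.
Qed.

Lemma deg_leM d e g h : deg_le d g -> deg_le e h -> deg_le (d + e) (fun w => g w * h w).
Proof.
move=> [L Ld gE] [M Me hE].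
exists [seq (a.1 * b.1, a.2 ++ b.2) | a <- L, b <- M].
  apply/allP => _ /allpairsP [[a b] /= [aL bM ->]] /=.
  by rewrite size_cat leq_add ?(allP Ld) ?(allP Me).
move=> w; rewrite big_allpairs_dep gE hE big_distrlr /=.
apply: eq_bigr => a _; apply: eq_bigr => b _.
by rewrite big_cat /= mulrACA.
Qed.

Lemma deg_leB d g h : deg_le d g -> deg_le d h -> deg_le d (fun w => g w - h w).
Proof.
move=> dg dh; apply: eq_deg_le (deg_leD dg (deg_leM (deg_le_const 0 (-1)) dh)) => w.
by rewrite mulN1r.
Qed.

Lemma deg_leX d m g : deg_le d g -> deg_le (m * d) (fun w => g w ^+ m).
Proof.
move=> dg; elim: m => [|m IHm]; first exact: deg_le_const.
by rewrite mulSn; apply: eq_deg_le (deg_leM dg IHm) => w; rewrite exprS.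
Qed.

Lemma deg_le_sum d (I : finType) (g : I -> 'rV['F_3]_N -> 'F_3) :
  (forall i, deg_le d (g i)) -> deg_le d (fun w => \sum_i g i w).
Proof.
move=> dg; elim: (index_enum I) => [|i r IHr].
  by exists [::] => // w; rewrite !big_nil.
by apply: eq_deg_le (deg_leD (dg i) IHr) => w; rewrite big_cons.
Qed.

Lemma deg_le_prod d (I : finType) (g : I -> 'rV['F_3]_N -> 'F_3) :
  (forall i, deg_le d (g i)) -> deg_le (#|I| * d) (fun w => \prod_i g i w).
Proof.
move=> dg.
have -> : #|I| = size (index_enum I) by rewrite [index_enum I]unlock -enumT cardT.
elim: (index_enum I) => [|i r IHr].
  by apply: eq_deg_le (deg_le_const 0 1) => w; rewrite big_nil.
by apply: eq_deg_le (deg_leM (dg i) IHr) => w; rewrite big_cons.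
Qed.

(* Chevalley: every monomial of degree < 2N has some exponent at most 1. *)
Lemma sum_deg_lt d g : deg_le d g -> (d < 2 * N)%N -> \sum_w g w = 0.
Proof.
move=> [L Ld gE] lt_d; under eq_bigr do rewrite gE.
rewrite exchange_big /= big_seq big1 // => m mL.
rewrite -mulr_sumr.
have /existsP [k lt_k2] : [exists k, (count_mem k m.2 < 2)%N].
  apply: contraTT (leq_ltn_trans (allP Ld m mL) lt_d).
  rewrite negb_exists -leqNgt => /forallP le2.
  have <- : (\sum_(k < N) count_mem k m.2 = size m.2)%N.
    under eq_bigr do rewrite -sum1_count.
    by rewrite -sum1_size [RHS](partition_big id predT) /=.
  rewrite mulnC -[in leqLHS](card_ord N) -sum_nat_const.
  by apply: leq_sum => k _; rewrite leqNgt le2.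
by rewrite (sum_monomial_low_degree lt_k2) mulr0.
Qed.
End PolynomialDegree.

(** * Character sums of the quadratic form *)

Definition chi (t : 'F_3) : algC := xi3 ^+ val t.

(** This gives the minimal polynomial of xi and, the square being negative, also shows that xi is
    not real. *)
Lemma xi3_twice : (2 * xi3 + 1) ^+ 2 = -3.
Proof.
have -> : 2 * xi3 + 1 = 'i * sqrtC 3 by rewrite /xi3; field.
by rewrite exprMn sqrCi sqrtCK mulN1r.
Qed.

Lemma xi3_sum : 1 + xi3 + xi3 ^+ 2 = 0.
Proof.
have -> : 1 + xi3 + xi3 ^+ 2 = ((2 * xi3 + 1) ^+ 2 + 3) / 4 by field.
by rewrite xi3_twice addNr mul0r.
Qed.

Lemma xi3_cube : xi3 ^+ 3 = 1.
Proof.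
have : (xi3 - 1) * (1 + xi3 + xi3 ^+ 2) = 0 by rewrite xi3_sum mulr0.
by move=> H; apply/eqP; rewrite -subr_eq0 -H; apply/eqP; ring.
Qed.

Lemma chiD a b : chi (a + b) = chi a * chi b.
Proof.
have chi_nat m : xi3 ^+ (m %% 3) = xi3 ^+ m.
  by rewrite [in RHS](divn_eq m 3) exprD mulnC exprM xi3_cube expr1n mul1r.
by rewrite /chi -exprD -(chi_nat (val a + val b)%N).
Qed.

Lemma chi0 : chi 0 = 1. Proof. by []. Qed.

Lemma sum_chi : \sum_t chi t = 0.
Proof. by rewrite sum_F3 /chi /= expr0 expr1 xi3_sum. Qed.

Lemma sum_chiM a : \sum_t chi (t * a) = if a == 0 then 3 else 0.
Proof.
case: eqP => [->|/eqP a0].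
  by under eq_bigr do rewrite mulr0; rewrite sum_F3 chi0; ring.
rewrite -[RHS]sum_chi [RHS](reindex (fun t => t * a)) //.
by exists (fun t => t / a) => t _; rewrite (mulfK, mulfVK).
Qed.

(** Both xi and xi^2 solve (2x + 1)^2 = -3, which no real x does. *)
Lemma chi_real c : chi c \is Num.real -> chi c = 1.
Proof.
have nreal x : (2 * x + 1 : algC) ^+ 2 = -3 -> x \is Num.real -> False.
  move=> x3 xr.
  have : 0 <= (2 * x + 1) ^+ 2.
    by rewrite real_exprn_even_ge0 // rpredD ?rpredM ?rpred_nat ?rpred1.
  by rewrite x3 oppr_ge0 lern0.
case: (F3_cases c) => -> //; rewrite /chi /= => /nreal[]; first exact: xi3_twice.
have -> : xi3 ^+ 2 = - (1 + xi3) by apply/eqP; rewrite -subr_eq0 opprK addrC xi3_sum.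
by rewrite -xi3_twice; ring.
Qed.

(** * The form f on abstract coordinate positions *)

Section DiagonalPlusHyperbolic.
Variables (N n1 n2 : nat) (x : 'I_n1 -> 'I_N) (y z : 'I_n2 -> 'I_N).
Implicit Types (c u v : 'I_n1 -> 'F_3) (w : 'rV['F_3]_N).

Definition diag_form c w := \sum_i c i * w 0 (x i) ^+ 2.
Definition hyp_form w := \sum_j w 0 (y j) * w 0 (z j).
Definition z_zero w := [forall j, w 0 (z j) == 0].
Definition switch_form u v w :=
  (if z_zero w then diag_form u w else diag_form v w) + hyp_form w.

Lemma switch_formZ u v a w : a != 0 -> switch_form u v (a *: w) = switch_form u v w.
Proof.
move=> a0; rewrite /switch_form /diag_form /hyp_form.
have -> : z_zero (a *: w) = z_zero w.
  by apply: eq_forallb => j; rewrite mxE mulf_eq0 (negPf a0).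
have E c : \sum_i c i * (a *: w) 0 (x i) ^+ 2 = \sum_i c i * w 0 (x i) ^+ 2.
  by apply: eq_bigr => i _; rewrite mxE exprMn (F3_sqr a0) mul1r.
rewrite !E; congr (_ + _); apply: eq_bigr => j _.
by rewrite !mxE mulrACA -expr2 (F3_sqr a0) mul1r.
Qed.

Hypotheses (x_inj : injective x) (y_inj : injective y).
Hypotheses (xNy : forall i j, x i != y j) (xNz : forall i j, x i != z j).
Hypothesis yNz : forall i j, y i != z j.

Lemma hyp_form_z_zero w : z_zero w -> hyp_form w = 0.
Proof.
by move=> /forallP z0; apply: big1 => j _; rewrite (eqP (z0 j)) mulr0.
Qed.

Lemma z_zero_line k t w :
  (forall j, k != z j) -> z_zero (w + t *: delta_mx 0 k) = z_zero w.
Proof.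
move=> kNz; apply: eq_forallb => j.
by rewrite !mxE [z j == k]eq_sym (negPf (kNz j)) andbF mulr0 addr0.
Qed.

Lemma switch_form_y_line u v j t w :
  switch_form u v (w + t *: delta_mx 0 (y j)) = switch_form u v w + t * w 0 (z j).
Proof.
rewrite /switch_form z_zero_line => [|i]; last exact: yNz.
have E c : diag_form c (w + t *: delta_mx 0 (y j)) = diag_form c w.
  by apply: eq_bigr => i _; rewrite !mxE (negPf (xNy _ _)) andbF mulr0 addr0.
rewrite !E -addrA; congr (_ + _).
rewrite /hyp_form [in LHS](bigD1 j) // [in RHS](bigD1 j) //= addrAC; congr (_ + _).
  by rewrite !mxE !eqxx mulr1 eq_sym (negPf (yNz _ _)) andbF mulr0 addr0 mulrDl.
apply: eq_bigr => i ne_ij; rewrite !mxE eqxx /= (inj_eq y_inj) (negPf ne_ij).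
by rewrite [z i == _]eq_sym (negPf (yNz _ _)) mulr0 !addr0.
Qed.

Lemma diag_form_x_line c k t w : w 0 (x k) = 0 ->
  diag_form c (w + t *: delta_mx 0 (x k)) = diag_form c w + c k * t ^+ 2.
Proof.
move=> wk0; rewrite /diag_form [in LHS](bigD1 k) // [in RHS](bigD1 k) //=.
rewrite !mxE !eqxx wk0 mulr1 add0r expr0n mulr0 add0r addrC; congr (_ + _).
by apply: eq_bigr => i ik; rewrite !mxE eqxx (inj_eq x_inj) (negPf ik) mulr0 addr0.
Qed.

(* When some z_j is nonzero, the character sum over the coordinate y_j vanishes. *)
Lemma sum_chi_switch_form u v a : a != 0 ->
  \sum_w chi (a * switch_form u v w) = \sum_(w | z_zero w) chi (a * diag_form u w).
Proof.
move=> a0; rewrite (bigID z_zero) /= [X in _ + X](_ : _ = 0) ?addr0.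
  by apply: eq_bigr => w z0; rewrite /switch_form z0 hyp_form_z_zero ?addr0.
pose J w := [pick j | w 0 (z j) != 0].
rewrite (partition_big J predT) //= big1 // => -[j|] _; last first.
  apply: big1 => w /andP[]; rewrite /J; case: pickP => // z0 /negP[].
  by apply/forallP => j; have /negbFE := z0 j.
rewrite big_mkcond (sum_over_lines (y j)) big1 // => w _.
have JE t : J (w + t *: delta_mx 0 (y j)) = J w.
  apply: eq_pick => i /=.
  by rewrite !mxE [z i == _]eq_sym (negPf (yNz _ _)) andbF mulr0 addr0.
under eq_bigr => t _ do rewrite JE z_zero_line //.
case: (boolP (~~ z_zero w && _)) => [/andP[_ /eqP Jw]|_] /=; last by rewrite big1.
have zj0 : w 0 (z j) != 0 by move: Jw; rewrite /J; case: pickP => // i zi [<-].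
under eq_bigr => t _ do rewrite switch_form_y_line mulrDr chiD mulrCA.
by rewrite -mulr_sumr sum_chiM mulf_eq0 (negPf a0) (negPf zj0) mulr0.
Qed.

(** On each line in direction x_k the two sums together carry the factor 2 (1 + chi(c_k) +
    chi(-c_k)) = 0, since t^2 takes the values 0, 1, 1. *)
Lemma sum_chi_diag_flip c c' k : c k != 0 -> c' k = - c k ->
  (forall i, i != k -> c' i = c i) ->
  \sum_(w | z_zero w) chi (diag_form c' w) = - \sum_(w | z_zero w) chi (diag_form c w).
Proof.
move=> ck0 c'k c'E; apply/eqP; rewrite -subr_eq0 opprK -big_split /=; apply/eqP.
rewrite big_mkcond (sum_over_lines (x k)) big1 // => w /eqP wk0.
under eq_bigr do rewrite z_zero_line // !diag_form_x_line // !chiD.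
case: (z_zero w); last by rewrite big1.
have -> : diag_form c' w = diag_form c w.
  apply: eq_bigr => i _; have [->|/c'E-> //] := eqVneq i k.
  by rewrite wk0 expr0n !mulr0.
under eq_bigr do rewrite -mulrDr.
rewrite -mulr_sumr sum_F3 c'k sqrrN !expr1n expr0n !mulr1 !mulr0 chi0.
have : 1 + chi (c k) + chi (- c k) = 0.
  by have := sum_chiM (c k); rewrite (negPf ck0) sum_F3 mul0r mul1r mulN1r chi0.
set p := chi _; set q := chi _ => pq0.
have -> : 1 + 1 + (q + p) + (q + p) = (1 + p + q) * 2 by ring.
by rewrite pq0 mul0r mulr0.
Qed.

Lemma sum_chi_diag_opp c : (forall i, c i != 0) ->
  \sum_(w | z_zero w) chi (- diag_form c w) =
    (-1) ^+ n1 * \sum_(w | z_zero w) chi (diag_form c w).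
Proof.
(* [cm m] negates the first m coefficients, leading from c to -c in n1 sign flips. *)
move=> c0; pose cm m (i : 'I_n1) := if (i < m)%N then - c i else c i.
suffices E m : (m <= n1)%N -> \sum_(w | z_zero w) chi (diag_form (cm m) w) =
    (-1) ^+ m * \sum_(w | z_zero w) chi (diag_form c w).
  rewrite -E //; apply: eq_bigr => w _; congr chi.
  by rewrite /diag_form -sumrN; apply: eq_bigr => i _; rewrite /cm ltn_ord mulNr.
elim: m => [|m IHm] lt_m; first by rewrite mul1r.
rewrite (@sum_chi_diag_flip (cm m) _ (Ordinal lt_m)).
- by rewrite IHm 1?ltnW // exprS mulN1r mulNr.
- by rewrite /cm /= ltnn.
- by rewrite /cm /= ltnn ltnSn.
by move=> i; rewrite /cm -val_eqE /= ltnS => ne_im; rewrite leq_eqVlt (negPf ne_im).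
Qed.

Lemma card_switch_form_zeros u v : (forall i, u i != 0) ->
  3 * #|[set w | switch_form u v w == 0]|%:R =
    3 ^+ N + (1 + (-1) ^+ n1) * \sum_w chi (switch_form u v w) :> algC.
Proof.
move=> u0.
(* Orthogonality of characters detects the zeros; the terms a = 0, 1, -1 are then evaluated
   separately. *)
have -> : 3 * #|[set w | switch_form u v w == 0]|%:R =
    \sum_w \sum_a chi (a * switch_form u v w).
  under [RHS]eq_bigr do rewrite sum_chiM.
  rewrite -big_mkcond sumr_const mulr_natr; congr (_ *+ _).
  by apply: eq_card => w; rewrite inE.
rewrite exchange_big sum_F3 /= -addrA; congr (_ + _).
  under eq_bigr do rewrite mul0r chi0.
  rewrite sumr_const card_mx card_Fp // mul1n.
  by rewrite natrX.
have one_neq0 : (1 : 'F_3) != 0 := oner_neq0 _.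
rewrite [X in _ + X]sum_chi_switch_form ?oppr_eq0 //.
under [X in _ + X]eq_bigr do rewrite mulN1r.
rewrite sum_chi_diag_opp // mulrDl mul1r.
under [X in X + _]eq_bigr do rewrite mul1r.
congr (_ + _ * _).
under [RHS]eq_bigr => w _ do rewrite -[switch_form u v w]mul1r.
by rewrite sum_chi_switch_form //; apply: eq_bigr => w _; rewrite mul1r.
Qed.

(** * Second moments over the zeros of f *)

Lemma indicator_F3 (t : 'F_3) : (t == 0)%:R = 1 - t ^+ 2 :> 'F_3.
Proof.
have [->|t0] := eqVneq t 0; first by rewrite expr0n subr0.
by rewrite F3_sqr ?subrr.
Qed.

(** Makes the case distinction on z polynomial, of degree at most 2 n2. *)
Lemma z_zero_indicator w : (z_zero w)%:R = \prod_j (1 - w 0 (z j) ^+ 2) :> 'F_3.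
Proof.
have [z0|] := boolP (z_zero w).
  by rewrite big1 // => j _; rewrite (eqP (forallP z0 j)) expr0n subr0.
rewrite negb_forall => /existsP [j zj0].
by rewrite (bigD1 j) //= F3_sqr // subrr mul0r.
Qed.

(* The degree bound in [switch_form_second_moment] may fail for n1 = 1 (say n2 = s = 1), but
   then u_1^2 = v_1^2 = 1 and the two branches of f have the same square. *)
Lemma diag_form_sqr_dim1 u v w : n1 = 1 ->
  (forall i, u i != 0) -> (forall i, v i != 0) -> diag_form u w ^+ 2 = diag_form v w ^+ 2.
Proof.
rewrite /diag_form; case: n1 x u v => [|[|//]] // x' u' v' _ u0 v0.
by rewrite !big_ord1 !exprMn (F3_sqr (u0 _)) (F3_sqr (v0 _)).
Qed.

Lemma deg_le_diag_form c : deg_le 2 (diag_form c).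
Proof.
apply: deg_le_sum => i.
exact: (deg_leM (deg_le_const _ 0 (c i)) (deg_leX 2 (deg_le_coord (x i)))).
Qed.

Lemma deg_le_hyp_form : deg_le 2 hyp_form.
Proof. by apply: deg_le_sum => j; exact: (deg_leM (deg_le_coord _) (deg_le_coord _)). Qed.

(** The hyperbolic part vanishes where z = 0, so f^2 is [Qv]^2 plus the indicator of z = 0 times
    [D]. The two resulting sums are treated separately by degree. *)
Lemma switch_form_second_moment u v i j :
  (forall k, u k != 0) -> (forall k, v k != 0) ->
  (3 < N)%N -> n1 = 1 \/ (n2 + 3 < N)%N ->
  \sum_(w | switch_form u v w == 0) w 0 i * w 0 j = 0 :> 'F_3.
Proof.
move=> u0 v0 N_gt3 small.
pose Qv w := diag_form v w + hyp_form w.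
pose D w := diag_form u w ^+ 2 - diag_form v w ^+ 2.
have F_sqr w : switch_form u v w ^+ 2 = Qv w ^+ 2 + (z_zero w)%:R * D w.
  rewrite /switch_form /Qv /D; have [z0|_] := boolP (z_zero w); last by rewrite mul0r addr0.
  by rewrite hyp_form_z_zero // !addr0 mul1r addrC subrK.
have -> : \sum_(w | switch_form u v w == 0) w 0 i * w 0 j =
    \sum_(w : 'rV_N) w 0 i * w 0 j * (1 - Qv w ^+ 2) -
    \sum_(w : 'rV_N) w 0 i * w 0 j * ((z_zero w)%:R * D w).
  rewrite -sumrB big_mkcond; apply: eq_bigr => w _.
  rewrite -mulrBr -addrA -opprD -F_sqr -indicator_F3.
  by case: eqP; rewrite ?mulr1 ?mulr0.
have deg_ij := deg_leM (deg_le_coord i) (deg_le_coord j).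
(* Two coordinates and a squared quadratic form: degree 6 < 2 N. *)
rewrite (@sum_deg_lt _ (1 + 1 + 2 * 2)) ?sub0r; last 2 first.
- apply: deg_leM => //; apply: deg_leB; first exact: deg_le_const.
  by apply: deg_leX; apply: deg_leD; [exact: deg_le_diag_form | exact: deg_le_hyp_form].
- lia.
case: small => [n1_1|lt_n2].
  rewrite big1 ?oppr0 // => w _.
  by rewrite /D (@diag_form_sqr_dim1 u v) // subrr !mulr0.
(* Two coordinates, the indicator of z = 0, and a difference of squared quadratic forms: 2 + 2 n2 +
   4 < 2 N. *)
rewrite (@sum_deg_lt _ (1 + 1 + (#|'I_n2| * (2 * 1) + 2 * 2))) ?oppr0 //; last first.
  by rewrite card_ord; lia.
apply: deg_leM => //; apply: deg_leM; last first.
  by apply: deg_leB; apply: deg_leX; apply: deg_le_diag_form.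
apply: (@eq_deg_le _ _ (fun w => \prod_j (1 - w 0 (z j) ^+ 2))).
  by move=> w; rewrite z_zero_indicator.
apply: deg_le_prod => k; apply: deg_leB; first exact: deg_le_const.
exact: deg_leX (deg_le_coord _).
Qed.

(** Either branch reduces to a single coefficient, u_k or v_k, so the value of z need not be
    known. *)
Lemma switch_form_unit_neq0 u v k w :
  (forall i, u i != 0) -> (forall i, v i != 0) ->
  (forall i, w 0 (x i) = (i == k)%:R) -> hyp_form w = 0 -> switch_form u v w != 0.
Proof.
move=> u0 v0 wx hw.
have E c : diag_form c w = c k.
  rewrite /diag_form (bigD1 k) //= wx eqxx expr1n mulr1 big1 ?addr0 // => i ik.
  by rewrite wx (negPf ik) expr0n mulr0.
by rewrite /switch_form hw addr0 !E; case: ifP.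
Qed.

Lemma switch_form_delta_y u v j : switch_form u v (delta_mx 0 (y j)) = 0.
Proof.
have zw : z_zero (delta_mx 0 (y j)).
  by apply/forallP => i; rewrite mxE eq_sym [z i == _]eq_sym (negPf (yNz _ _)) andbF.
rewrite /switch_form zw hyp_form_z_zero // addr0; apply: big1 => i _.
by rewrite mxE (negPf (xNy _ _)) andbF expr0n mulr0.
Qed.
End DiagonalPlusHyperbolic.

(** * Representatives of the zeros up to scalars *)

Section Representatives.
Variables (N : nat) (F : 'rV['F_3]_N -> 'F_3) (T : {set 'rV['F_3]_N}).
Hypothesis F0 : F 0 = 0.
Hypothesis FZ : forall a w, a != 0 -> F (a *: w) = F w.
Hypothesis subT : T \subset [set w | (F w == 0) && (w != 0)].
Hypothesis uniqT : forall w : 'rV['F_3]_N, F w = 0 -> w != 0 ->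
  exists! ax : 'F_3 * 'rV['F_3]_N, [/\ ax.1 != 0, ax.2 \in T & w = ax.1 *: ax.2].

Lemma repr_zero t : t \in T -> F t = 0.
Proof. by move=> /(subsetP subT); rewrite inE => /andP[/eqP]. Qed.

Lemma repr_neq0 t : t \in T -> t != 0.
Proof. by move=> /(subsetP subT); rewrite inE => /andP[]. Qed.

(** Both (1, t) and (a, t') represent t. *)
Lemma repr_inj t t' a : t \in T -> t' \in T -> t = a *: t' -> t = t'.
Proof.
move=> tT t'T E.
have a0 : a != 0.
  by apply: contraNneq (repr_neq0 tT) => a0; rewrite E a0 scale0r.
have [ax [_ ax_uniq]] := uniqT (repr_zero tT) (repr_neq0 tT).
have H1 : ax = (1, t) by apply: ax_uniq; rewrite scale1r.
by have := ax_uniq (a, t') (And3 a0 t'T E); rewrite H1 => -[_ ->].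
Qed.

(** As the nonzero scalars are 1 and -1, the nonzero zeros are the disjoint union of T and -T. *)
Lemma sum_zeros (V : zmodType) (h : 'rV['F_3]_N -> V) :
  \sum_(w | F w == 0) h w = h 0 + \sum_(t in T) (h t + h (- t)).
Proof.
have optT : [disjoint T & [set - t | t in T]].
  rewrite -setI_eq0; apply/eqP/setP => w; rewrite !inE.
  apply/andP => -[wT /imsetP [t tT wE]].
  have wt := repr_inj wT tT (etrans wE (esym (scaleN1r t))).
  have := repr_neq0 wT; rewrite -wt in wE.
  apply/negP; rewrite negbK; apply/eqP/rowP => i.
  have /eqP := congr1 (fun m : 'rV_N => m 0 i) wE; rewrite !mxE.
  by case: (F3_cases (w 0 i)) => ->.
rewrite (bigD1 0) ?F0 //=; congr (_ + _).
rewrite big_split /= -[X in _ + X](big_imset h) /=; last by move=> ? ? _ _ /oppr_inj.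
rewrite -bigU //=; apply: eq_bigl => w; rewrite inE.
apply/andP/orP => [[/eqP Fw w0]|[wT|/imsetP [t tT ->]]].
- have [[a t] [[/= a0 tT wE] _]] := uniqT Fw w0.
  case: (F3_cases a) a0 wE => -> a0 wE; first by rewrite eqxx in a0.
    by left; rewrite wE scale1r.
  by right; apply/imsetP; exists t; rewrite // wE scaleN1r.
- by rewrite repr_zero ?repr_neq0.
by rewrite -scaleN1r FZ ?repr_zero // scaleN1r oppr_eq0 repr_neq0.
Qed.

Lemma card_zeros : #|[set w | F w == 0]| = (1 + 2 * #|T|)%N.
Proof.
apply/eqP; rewrite -(eqr_nat int).
have -> : #|[set w | F w == 0]|%:R = (\sum_(w | F w == 0) 1 : int).
  by rewrite sumr_const; congr _%:R; apply: eq_card => w; rewrite inE.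
by rewrite sum_zeros sumr_const natrD natrM mulr_natr.
Qed.
End Representatives.

(** * LCD codes and dual distance *)

(** Massey's criterion: a codeword D M in the dual satisfies D M M^T = 0, hence D = 0. The dual is
    LCD because the bidual is the code itself. *)
Lemma gram_LCD k L (M : 'M['F_3]_(k, L)) : M *m M^T \in unitmx ->
  [/\ \rank M = k, is_LCD M, \rank (dual_code M) = (L - k)%N & is_LCD (dual_code M)].
Proof.
move=> uM.
have rM : \rank M = k.
  apply/eqP; rewrite eqn_leq rank_leq_row -[in leqLHS](mxrank_unit uM).
  exact: mxrankM_maxl.
have rD : \rank (dual_code M) = (L - k)%N by rewrite mxrank_ker mxrank_tr rM.
have lcdM : is_LCD M.
  apply/eqP; set C := (M :&: _)%MS.
  have /submxP [D CE] : (C <= M)%MS := capmxSl _ _.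
  have /sub_kermxP := capmxSr M (dual_code M); rewrite -/C CE -mulmxA => DM0.
  by rewrite -(mulmxK uM D) DM0 !mul0mx.
have bidual : (dual_code (dual_code M) <= M)%MS.
  have le : (M <= dual_code (dual_code M))%MS.
    apply/sub_kermxP; apply: trmx_inj; rewrite trmx_mul trmxK trmx0.
    exact: mulmx_ker.
  have := mxrank_leqif_eq le; rewrite mxrank_ker mxrank_tr rD rM subKn.
    by move=> [_ /esym]; rewrite eqxx => /andP[].
  by rewrite -rM rank_leq_col.
split; [exact: rM | exact: lcdM | exact: rD |].
rewrite /is_LCD -submx0 -(eqP lcdM).
by rewrite [X in (_ <= X)%MS]capmxC capmxS.
Qed.

(** A relation of weight 1 would give a zero row of C, one of weight 2 two proportional rows. *)
Lemma wt_ge3 L N (C : 'M['F_3]_(L, N)) (v : 'rV['F_3]_L) :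
  (forall k, row k C != 0) ->
  (forall k l a, a != 0 -> row k C = a *: row l C -> k = l) ->
  v *m C = 0 -> v != 0 -> (3 <= wt v)%N.
Proof.
move=> C0 Cinj vC v0; rewrite /wt; set S := [set i | _].
have : \sum_(i in S) v 0 i *: row i C = 0.
  rewrite -[RHS]vC mulmx_sum_row big_mkcond; apply: eq_bigr => i _.
  by rewrite inE; case: eqP => // ->; rewrite scale0r.
have vS i : i \in S -> v 0 i != 0 by rewrite inE.
have : S != set0.
  apply: contraNneq v0 => S0; apply/eqP/rowP => i; rewrite mxE.
  by apply/eqP; rewrite -[_ == _]negbK; have := in_set0 i; rewrite -S0 inE => ->.
rewrite -card_gt0; case E: #|S| => [|[|[|//]]] // _.
  have /cards1P [k SE] : #|S| == 1%N by rewrite E.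
  rewrite SE big_set1 => /eqP; rewrite scaler_eq0 (negPf (C0 k)) orbF.
  by rewrite (negPf (vS k _)) // SE set11.
have /cards2P [k [l [kl SE]]] : #|S| == 2 by rewrite E.
rewrite SE big_setU1 ?inE //= big_set1 => /eqP; rewrite addr_eq0 => /eqP kl0.
have vk : v 0 k != 0 by rewrite vS // SE !inE eqxx.
have vl : v 0 l != 0 by rewrite vS // SE !inE eqxx orbT.
case/eqP: kl; apply: (Cinj k l (- (v 0 l / v 0 k))).
  by rewrite oppr_eq0 mulf_neq0 ?invr_eq0.
apply: (scalerI vk); rewrite kl0 scalerA -scaleNr; congr (_ *: _).
by rewrite mulrN mulrC divfK.
Qed.

(** * Codes generated by A [A^T, X] *)

Section CodeFromRepresentatives.
Variables (N : nat) (A : 'M['F_3]_N) (T : {set 'rV['F_3]_N}).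
Hypothesis uA : A \in unitmx.
Let X : 'M['F_3]_(N, #|T|) := \matrix_(i, j) (enum_val j : 'rV_N) 0 i.
Let G : 'M['F_3]_(N, N + #|T|) := row_mx (A *m A^T) (A *m X).

Lemma repr_code_LCD :
  (forall i j, \sum_(t in T) (t : 'rV_N) 0 i * (t : 'rV_N) 0 j = 0) ->
  [/\ \rank G = N, is_LCD G, \rank (dual_code G) = #|T| & is_LCD (dual_code G)].
Proof.
move=> T0; have [] := @gram_LCD _ _ G; last by rewrite addKn.
rewrite tr_row_mx mul_row_col !trmx_mul trmxK mulmxA.
have -> : A *m X *m (X^T *m A^T) = 0.
  rewrite mulmxA -[A *m X *m X^T]mulmxA (_ : X *m X^T = 0) ?mulmx0 ?mul0mx //.
  apply/matrixP => i j; rewrite !mxE -[RHS](T0 i j) [RHS]big_enum_val.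
  by apply: eq_bigr => k _; rewrite !mxE.
by rewrite addr0 !unitmx_mul unitmx_tr uA.
Qed.

(** Cancelling the invertible A^T leaves parity checks whose rows are the rows of A and the elements
    of T. *)
Lemma sub_dual_code (v : 'rV_(N + #|T|)) :
  (v <= dual_code G)%MS = (v *m col_mx A X^T == 0).
Proof.
rewrite /dual_code (sameP sub_kermxP eqP).
have -> : G^T = col_mx A X^T *m A^T by rewrite tr_row_mx !trmx_mul trmxK mul_col_mx.
rewrite mulmxA; apply/eqP/eqP => [vC|->]; last by rewrite mul0mx.
have uAT : A^T \in unitmx by rewrite unitmx_tr.
by rewrite -(mulmxK uAT (v *m _)) vC mul0mx.
Qed.

Lemma row_repr (k : 'I_#|T|) : row k X^T = enum_val k.
Proof. by apply/rowP => i; rewrite !mxE. Qed.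

Lemma repr_code_dual_min_dist :
  (forall t, t \in T -> t != 0) ->
  (forall t t' a, t \in T -> t' \in T -> t = a *: t' -> t = t') ->
  (forall i t a, t \in T -> row i A != a *: t) ->
  (exists i j t a, [/\ i != j, t \in T, a != 0 & row i A - row j A = a *: t]) ->
  min_dist_is (dual_code G) 3.
Proof.
move=> Tn0 Tinj AT [i [j [t [a [ij tT a0 ijt]]]]].
(* The scalar 0 is allowed in [AT]. *)
have rowA_neq0 k : row k A != 0 by have := AT k t 0 tT; rewrite scale0r.
have rowA_inj k l c : row k A = c *: row l A -> k = l.
  rewrite !rowE scalemxAl => /(can_inj (mulmxK uA)) /rowP /(_ k).
  by rewrite !mxE !eqxx /=; case: eqP => // _ /eqP; rewrite mulr0 oner_eq0.
split; last first.
  move=> v; rewrite sub_dual_code => /eqP; apply: wt_ge3 => [k|k l c c0].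
    by case: (split_ordP k) => k' ->; rewrite ?rowKu ?rowKd ?row_repr // Tn0 ?enum_valP.
  case: (split_ordP k) => k' ->; case: (split_ordP l) => l' ->;
    rewrite ?rowKu ?rowKd ?row_repr.
  - by move=> /rowA_inj ->.
  - by move/eqP; rewrite (negPf (AT _ _ _ (enum_valP _))).
  - move=> kl; have := AT l' _ c^-1 (enum_valP k').
    by rewrite kl scalerA mulVf // scale1r eqxx.
  by move=> /(Tinj _ _ _ (enum_valP _) (enum_valP _))/enum_val_inj ->.
(* The relation row i - row j - a t = 0 is read as a dual codeword of weight 3; [k] is the position
   of t. *)
pose k := rshift N (enum_rank_in tT t).
pose v : 'rV['F_3]_(N + #|T|) :=
  delta_mx 0 (lshift _ i) - delta_mx 0 (lshift _ j) - a *: delta_mx 0 k.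
have ki l : (lshift #|T| l == k) = false by exact: eq_lrshift.
have ik l : (k == lshift #|T| l) = false by exact: eq_rlshift.
have wv : wt v = 3.
  rewrite /wt (_ : [set _ | _] = [set lshift _ i; lshift _ j; k]).
    rewrite setUC cardsU1 cards2 !inE !ik (inj_eq (@lshift_inj _ _)) ij.
    by [].
  apply/setP => l; rewrite !inE !mxE /=.
  have [->|li] := eqVneq l (lshift _ i).
    by rewrite (inj_eq (@lshift_inj _ _)) (negPf ij) ki mulr0 !subr0 oner_eq0.
  have [->|lj] := eqVneq l (lshift _ j); first by rewrite ki mulr0 subr0.
  rewrite subrr sub0r oppr_eq0.
  by case: (l == k); rewrite ?mulr1 ?a0 // mulr0 eqxx.
exists v; split=> //.
  rewrite sub_dual_code !mulmxBl -scalemxAl -!rowE !rowKu rowKd row_repr.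
  by rewrite enum_rankK_in // ijt subrr.
by apply: contra_eq_neq wv => ->; rewrite /wt eq_card0 // => l; rewrite !inE mxE eqxx.
Qed.
End CodeFromRepresentatives.

(** * The code of f *)

Lemma coord_atE N (w : 'rV['F_3]_N) (i : 'I_N) : coord_at w i = w 0 i.
Proof. by rewrite /coord_at valK. Qed.

Lemma fquadE N n1 n2 (u v : 'I_n1 -> 'F_3) (x : 'I_n1 -> 'I_N) (y z : 'I_n2 -> 'I_N) :
  (forall i, x i = i :> nat) -> (forall j, y j = (n1 + j)%N :> nat) ->
  (forall j, z j = (n1 + n2 + j)%N :> nat) ->
  fquad n2 u v =1 switch_form x y z u v.
Proof.
move=> xE yE zE w; rewrite /fquad /switch_form /z_zero /diag_form /hyp_form.
congr (_ + _); first congr (if _ then _ else _).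
- by apply: eq_forallb => j; rewrite -zE coord_atE.
- by apply: eq_bigr => i _; rewrite -[in LHS]xE coord_atE.
- by apply: eq_bigr => i _; rewrite -[in LHS]xE coord_atE.
by apply: eq_bigr => j _; rewrite -zE -yE !coord_atE.
Qed.

Definition alpha_mx n1 N : 'M['F_3]_N := \matrix_(i, j) alpha n1 i 0 j.

Lemma row_alpha_mx n1 N (i : 'I_N) : row i (alpha_mx n1 N) = alpha n1 i.
Proof. by apply/rowP => j; rewrite !mxE. Qed.

(** Since n1 > 0, the extra entry 1 of the later rows, in column 0, lies strictly left of the
    diagonal: the matrix is lower unitriangular. *)
Lemma alpha_mx_unit n1 N : (0 < n1)%N -> alpha_mx n1 N \in unitmx.
Proof.
move=> n1_gt0; rewrite unitmxE det_trig.
  rewrite big1 ?unitr1 // => i _; rewrite !mxE eqxx; case: ltnP => // le_n1.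
  by rewrite eqn0Ngt (leq_trans n1_gt0 le_n1) add0r.
apply/is_trig_mxP => i j lt_ij; rewrite !mxE.
have /negPf-> : j != i by rewrite -val_eqE neq_ltn lt_ij orbT.
by case: ifP => // _; rewrite eqn0Ngt (leq_ltn_trans _ lt_ij) // addr0.
Qed.

Lemma GprimeE n1 N (T : {set 'rV['F_3]_N}) :
  Gprime n1 T = row_mx (alpha_mx n1 N *m (alpha_mx n1 N)^T)
    (alpha_mx n1 N *m \matrix_(i < N, j < #|T|) (enum_val j : 'rV_N) 0 i).
Proof.
by congr row_mx; apply/matrixP => i j; rewrite !mxE; apply: eq_bigr => k _; rewrite !mxE.
Qed.

(** Powers of 9 are 1 modulo 4. *)
Lemma mu_even m : ~~ odd m -> mu m = 1.
Proof.
move=> m_even; rewrite /mu -(even_halfK m_even) -mul2n expnM -modnXm exp1n.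
by rewrite eqxx.
Qed.

Lemma alpha_coord_neq0 n1 N (i k : 'I_N) : (0 < k)%N -> alpha n1 i 0 k = (k == i)%:R.
Proof. by move=> k_gt0; rewrite mxE eqn0Ngt k_gt0 add0r; case: ifP. Qed.

(** * Positions of the blocks x, y, z *)

Section CoordinateBlocks.
Variables (n1 n2 s : nat).
Let N := (n1 + 2 * n2 + s)%N.

Lemma x_block_proof (i : 'I_n1) : (i < N)%N.
Proof. by rewrite /N; have := ltn_ord i; lia. Qed.
Lemma y_block_proof (j : 'I_n2) : (n1 + j < N)%N.
Proof. by rewrite /N; have := ltn_ord j; lia. Qed.
Lemma z_block_proof (j : 'I_n2) : (n1 + n2 + j < N)%N.
Proof. by rewrite /N; have := ltn_ord j; lia. Qed.

Definition x_block i := Ordinal (x_block_proof i).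
Definition y_block j := Ordinal (y_block_proof j).
Definition z_block j := Ordinal (z_block_proof j).

Lemma x_block_inj : injective x_block.
Proof. by move=> i j /(congr1 val) /= /val_inj. Qed.
Lemma y_block_inj : injective y_block.
Proof. by move=> i j /(congr1 val) /= /addnI /val_inj. Qed.
Lemma x_neq_y i j : x_block i != y_block j.
Proof. by rewrite -val_eqE /=; have := ltn_ord i; lia. Qed.
Lemma x_neq_z i j : x_block i != z_block j.
Proof. by rewrite -val_eqE /=; have := ltn_ord i; lia. Qed.
Lemma y_neq_z i j : y_block i != z_block j.
Proof. by rewrite -val_eqE /=; have := ltn_ord i; lia. Qed.

Lemma fquad_blocks (u v : 'I_n1 -> 'F_3) : fquad n2 u v =1 switch_form x_block y_block z_block u v.
Proof. exact: fquadE. Qed.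

(** The x part of alpha_i is a unit vector, namely e_i or e_1, and at most one y or z coordinate is
    nonzero, which kills the hyperbolic part. *)
Lemma fquad_alpha_neq0 (u v : 'I_n1 -> 'F_3) (i : 'I_N) :
  (0 < n1)%N -> (forall k, u k != 0) -> (forall k, v k != 0) ->
  fquad n2 u v (alpha n1 i) != 0.
Proof.
move=> n1_gt0 u0 v0; rewrite fquad_blocks.
have hyp0 : hyp_form y_block z_block (alpha n1 i) = 0.
  apply: big1 => j _; rewrite !alpha_coord_neq0 /= ?addn_gt0 ?n1_gt0 //.
  case: eqP => [<-|_]; last by rewrite mul0r.
  by rewrite [z_block j == _]eq_sym (negPf (y_neq_z _ _)) mulr0.
have [lt_i|le_i] := ltnP i n1.
  apply: (@switch_form_unit_neq0 _ _ _ _ _ _ u v (Ordinal lt_i)) => // k.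
  by rewrite mxE lt_i -val_eqE.
apply: (@switch_form_unit_neq0 _ _ _ _ _ _ u v (Ordinal n1_gt0)) => // k.
rewrite mxE ltnNge le_i /= [x_block k == i]negbTE ?addr0 //.
by rewrite -val_eqE /= neq_ltn (leq_trans (ltn_ord k)).
Qed.
End CoordinateBlocks.

Lemma expr_predl (R : pzSemiRingType) (a : R) k : (0 < k)%N -> a ^+ k = a * a ^+ (k - 1).
Proof. by case: k => // k _; rewrite subn1 exprS. Qed.

(** * Length, dimension and dual distance of the code *)

Section CodeOfQuadraticForm.
Variables (n1 n2 s : nat) (u v : 'I_n1 -> 'F_3).
Let n := (n1 + 2 * n2 + s)%N.
Let f : 'rV['F_3]_n -> 'F_3 := fquad n2 u v.
Variable T : {set 'rV['F_3]_n}.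
Hypothesis u0 : forall i, u i != 0.
Hypothesis subT : T \subset [set w | (f w == 0) && (w != 0)].
Hypothesis uniqT : forall w : 'rV['F_3]_n, f w = 0 -> w != 0 ->
  exists! ax : 'F_3 * 'rV['F_3]_n, [/\ ax.1 != 0, ax.2 \in T & w = ax.1 *: ax.2].

Lemma fquadZ a (w : 'rV_n) : a != 0 -> f (a *: w) = f w.
Proof. by move=> a0; rewrite /f !fquad_blocks switch_formZ. Qed.

Lemma fquad0 : f 0 = 0.
Proof.
rewrite /f fquad_blocks /switch_form hyp_form_z_zero ?addr0.
  have diag0 c : diag_form (@x_block n1 n2 s) c 0 = 0.
    by apply: big1 => i _; rewrite mxE expr0n mulr0.
  by rewrite !diag0 if_same.
by apply/forallP => j; rewrite mxE.
Qed.

Lemma card_repr_zeros :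
  3 * (1 + 2 * #|T|%:R) =
    3 ^+ n + (1 + (-1) ^+ n1) * walsh f 0 :> algC.
Proof.
have -> : walsh f 0 = \sum_w chi (switch_form (@x_block n1 n2 s) (@y_block n1 n2 s)
    (@z_block n1 n2 s) u v w).
  apply: eq_bigr => w _; rewrite /f fquad_blocks.
  by rewrite /dot big1 ?subr0 // => i _; rewrite mxE mul0r.
rewrite -card_switch_form_zeros //.
- have := card_zeros fquad0 fquadZ subT uniqT.
  rewrite (eq_card (B := [set w | switch_form (@x_block n1 n2 s) (@y_block n1 n2 s)
    (@z_block n1 n2 s) u v w == 0])); last by move=> w; rewrite !inE /f fquad_blocks.
  by move=> ->; rewrite natrD natrM.
- exact: x_block_inj.
- exact: y_block_inj.
- exact: x_neq_y.
- exact: x_neq_z.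
exact: y_neq_z.
Qed.

Lemma card_repr_odd : odd n1 -> #|T|%:R = (3 ^+ (n - 1) - 1) / 2 :> rat.
Proof.
move=> odd_n1; have := card_repr_zeros.
rewrite -signr_odd odd_n1 expr1 subrr mul0r addr0 => E.
have {}E : (3 * (1 + 2 * #|T|) = 3 ^ n)%N.
  by apply/eqP; rewrite -(eqr_nat algC) natrM natrD natrM natrX E.
have := congr1 (fun k => k%:R : rat) E; rewrite natrM natrD natrM natrX.
rewrite expr_predl; last by rewrite /n; lia.
by lra.
Qed.

Hypothesis n1_gt0 : (0 < n1)%N.

Lemma card_repr_even eps : ~~ odd n1 -> is_type s f eps ->
  #|T|%:R = (3 ^+ (n - 1) + 2 * eps%:~R * 3 ^+ ((n + s)./2 - 1) - 1) / 2 :> rat.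
Proof.
move=> even_n1 [eps_sign [c Wc]]; have := card_repr_zeros.
(* n + s = n1 + 2 n2 + 2 s has the parity of n1. *)
have even_ns : ~~ odd (n + s) by rewrite /n; lia.
rewrite -signr_odd (negPf even_n1) expr0.
set m := (n + s)./2.
have m2 : (n + s)%N = (2 * m)%N by rewrite mul2n even_halfK.
rewrite Wc mu_even // mulr1 m2 exprM sqrtCK -/(chi c).
set P : algC := eps%:~R * 3 ^+ m.
have P_neq0 : P != 0.
  rewrite mulf_neq0 ?expf_neq0 ?pnatr_eq0 // intr_eq0.
  by case: eps_sign => ->.
move=> E.
(* The counting identity exhibits chi(c) as a quotient of rational numbers, hence as real. *)
have chi1 : chi c = 1.
  apply: chi_real.
  have -> : chi c = (3 * (1 + 2 * #|T|%:R) - 3 ^+ n) / (2 * P).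
    by rewrite E; field.
  by rewrite rpred_div ?rpredB ?rpredM ?rpredD ?rpredM ?rpredX ?rpred1 ?realn ?realz.
rewrite chi1 mulr1 in E.
have {}E : 3 * (1 + 2 * #|T|%:R) = 3 ^+ n + (1 + 1) * (eps * 3 ^+ m) :> int.
  apply: (@intr_inj algC).
  by rewrite !(rmorphM, rmorphD, rmorphXn, rmorph1, rmorph_nat) /=.
have := congr1 (fun k => k%:~R : rat) E.
rewrite !(rmorphM, rmorphD, rmorphXn, rmorph1, rmorph_nat) /=.
rewrite (@expr_predl _ _ n) ?(@expr_predl _ _ m); [by lra | lia | rewrite /n; lia].
Qed.

Hypotheses (n2_gt0 : (0 < n2)%N) (v0 : forall i, v i != 0).

Lemma repr_code_parameters : (3 < n)%N -> n1 = 1%N \/ (n2 + 3 < n)%N ->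
  [/\ \rank (Gprime n1 T) = n, is_LCD (Gprime n1 T),
      \rank (dual_code (Gprime n1 T)) = #|T|, is_LCD (dual_code (Gprime n1 T))
    & min_dist_is (dual_code (Gprime n1 T)) 3].
Proof.
move=> n_gt3 small; rewrite GprimeE; set A := alpha_mx n1 n.
have uA : A \in unitmx := alpha_mx_unit n n1_gt0.
have [|rG lcdG rD lcdD] := @repr_code_LCD _ _ T uA.
  move=> i j.
  have := @switch_form_second_moment _ _ _ (@x_block n1 n2 s) (@y_block n1 n2 s)
    (@z_block n1 n2 s) u v i j u0 v0 n_gt3 small.
  under eq_bigl => w do rewrite -fquad_blocks.
  rewrite (sum_zeros fquad0 fquadZ subT uniqT (fun w => w 0 i * w 0 j)).
  rewrite !mxE mul0r add0r.
  (* Since w_i w_j is even, the sum over the zeros is twice the sum over T, and 2 is invertible in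
     F_3. *)
  under eq_bigr => t _ do rewrite !mxE mulrNN -mulr2n.
  rewrite sumrMnl; move: (\sum_(t in T) _) => S.
  by case: (F3_cases S) => -> // /eqP.
split; [exact: rG | exact: lcdG | exact: rD | exact: lcdD |].
apply: repr_code_dual_min_dist => //.
- exact: repr_neq0 subT.
- exact: repr_inj subT uniqT.
- move=> i t a tT; rewrite row_alpha_mx; apply/eqP => E.
  have := @fquad_alpha_neq0 n1 n2 s u v i n1_gt0 u0 v0; rewrite E -/f.
  have [->|a0] := eqVneq a 0; first by rewrite scale0r fquad0 eqxx.
  by rewrite fquadZ // (repr_zero subT tT) eqxx.
(* The word of weight 3: alpha_y0 - alpha_x0 is the zero e_y0 of f, which is a multiple of some t in
   T. *)
pose y0 := @y_block n1 n2 s (Ordinal n2_gt0).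
pose x0 := @x_block n1 n2 s (Ordinal n1_gt0).
have ey0 : f (delta_mx 0 y0) = 0.
  rewrite /f fquad_blocks switch_form_delta_y //; [exact: x_neq_y|exact: y_neq_z].
have ey_neq0 : delta_mx 0 y0 != 0 :> 'rV['F_3]_n.
  by apply/eqP => /rowP /(_ y0) /eqP; rewrite !mxE !eqxx oner_eq0.
have [[a t] [[/= a0 tT E] _]] := uniqT ey0 ey_neq0.
exists y0, x0, t, a; split=> //; first by rewrite eq_sym x_neq_y.
rewrite -E !row_alpha_mx; apply/rowP => k; rewrite !mxE /= n1_gt0 addn0 ltnn.
by rewrite -[k == x0]val_eqE /= addrC addrA addNr add0r.
Qed.
End CodeOfQuadraticForm.
Unset Implicit Arguments.

Theorem theorem11 (n1 n2 s n : nat) (u v : 'I_n1 -> 'F_3)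
  (T : {set 'rV['F_3]_n}) (eps : int) :
  (1 <= n1)%N -> (1 <= n2)%N -> n = (n1 + 2 * n2 + s)%N ->
  (forall i, u i != 0) -> (forall i, v i != 0) ->
  is_type s (fquad (N:=n) n2 u v) eps ->
  T \subset [set w | (fquad n2 u v w == 0) && (w != 0)] ->
  (forall w : 'rV['F_3]_n, fquad n2 u v w = 0 -> w != 0 ->
     exists! ax : 'F_3 * 'rV['F_3]_n, [/\ ax.1 != 0, ax.2 \in T & w = ax.1 *: ax.2]) ->
  (~~ odd (n + s) -> (s + 4 <= n)%N -> (6 <= n + s)%N ->
     let K : rat := (3 ^+ (n - 1) + 2 * eps%:~R * 3 ^+ ((n + s)./2 - 1) - 1) / 2 in
     [/\ ((n + #|T|)%N%:R : rat) = K + n%:R,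
         \rank (Gprime n1 T) = n,
         is_LCD (Gprime n1 T) &
       [/\ (\rank (dual_code (Gprime n1 T)))%:R = K,
         is_LCD (dual_code (Gprime n1 T))
       & min_dist_is (dual_code (Gprime n1 T)) 3]]) /\
  (odd (n + s) -> (s + 3 <= n)%N -> (5 <= n + s)%N ->
     let K : rat := (3 ^+ (n - 1) - 1) / 2 in
     [/\ ((n + #|T|)%N%:R : rat) = K + n%:R,
         \rank (Gprime n1 T) = n,
         is_LCD (Gprime n1 T) &
       [/\ (\rank (dual_code (Gprime n1 T)))%:R = K,
         is_LCD (dual_code (Gprime n1 T))
       & min_dist_is (dual_code (Gprime n1 T)) 3]]).
Proof.
move=> n1_gt0 n2_gt0 nE; subst n => u0 v0 f_type subT uniqT.
split=> [even_ns le_s gt6|odd_ns le_s gt5] K.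
  have even_n1 : ~~ odd n1 by lia.
  (* Here n1 >= 2, and n1 = 2, n2 = 1 forces s >= 1 by n + s >= 6; so n1 + n2 + s > 3, that is n2 +
     3 < n. *)
  have [||rG lcdG rD lcdD dist] :=
    repr_code_parameters u0 subT uniqT n1_gt0 n2_gt0 v0; [lia | lia |].
  have TE : #|T|%:R = K := card_repr_even u0 subT uniqT n1_gt0 even_n1 f_type.
  rewrite natrD rD TE addrC.
  by split; [| exact: rG | exact: lcdG | split; [| exact: lcdD | exact: dist]].
have odd_n1 : odd n1 by lia.
(* Either n1 = 1, where n + s >= 5 gives n > 3, or n1 >= 3, where n2 >= 1 gives n2 + 3 < n. *)
have [||rG lcdG rD lcdD dist] :=
  repr_code_parameters u0 subT uniqT n1_gt0 n2_gt0 v0; [lia | lia |].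
have TE : #|T|%:R = K := card_repr_odd u0 subT uniqT odd_n1.
rewrite natrD rD TE addrC.
by split; [| exact: rG | exact: lcdG | split; [| exact: lcdD | exact: dist]].
Qed.
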